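(* Let $d,k$ be positive integers. (a) For every $S \in \mathcal{S}^d(k)$ there exists an interior lattice point of $S$ all of whose barycentric coordinates with respect to $S$ are at least $\frac{1}{(d+1)(s_{d+1}-1)}$. (b) $p(d,k) \le \bigl(d(2d+1)(s_{2d+1}-1)\bigr)^d\, k$.
   Context: A lattice polytope in $\mathbb{R}^d$ is a polytope all of whose vertices lie in $\mathbb{Z}^d$. For positive integers $d,k$, $\mathcal{P}^d(k)$ denotes the family of all $d$-dimensional lattice polytopes in $\mathbb{R}^d$ having exactly $k$ interior lattice points (points of $\mathbb{Z}^d$ in the interior), $\mathcal{S}^d(k)$ the family of simplices in $\mathcal{P}^d(k)$, and $p(d,k) := \max\{\operatorname{vol}(P) : P \in \mathcal{P}^d(k)\}$, where $\operatorname{vol}$ is Lebesgue measure normalized so that $\operatorname{vol}([0,1]^d)=1$. For a $d$-simplex $S$ with vertices $v_1,\dots,v_{d+1}$, the barycentric coordinates of $x$ are the unique reals $\beta_1,\dots,\beta_{d+1}$ with $x=\sum_i \beta_i v_i$ and $\sum_i\beta_i=1$. The Sylvester sequence is defined by $s_1 := 2$ and $s_i := 1 + s_1 s_2 \cdots s_{i-1}$ for $i \ge 2$. *)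

(* Defs.v *)
From HB Require Import structures.
From mathcomp Require Import all_boot all_order all_algebra.
From mathcomp Require Import all_classical all_reals all_analysis.
Set Implicit Arguments. Unset Strict Implicit. Unset Printing Implicit Defensive.
Import Order.TTheory GRing.Theory Num.Theory.
Import numFieldNormedType.Exports.
Local Open Scope classical_set_scope.
Local Open Scope ring_scope.

(* Sylvester sequence: sylv_prod n = s_1 * ... * s_n, s_i = 1 + s_1 ... s_(i-1). *)
Fixpoint sylv_prod (n : nat) : nat :=
  if n is n'.+1 then sylv_prod n' * (sylv_prod n').+1 else 1.
Definition sylv (i : nat) : nat := (sylv_prod i.-1).+1.

Lemma sylv_prodE n : sylv_prod n = \prod_(1 <= j < n.+1) sylv j.
Proof.
elim: n => [|n IH]; first by rewrite big_geq.
by rewrite big_nat_recr //= -IH /sylv.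
Qed.

Lemma sylv1 : sylv 1 = 2%N. Proof. by []. Qed.
Lemma sylvE i : (1 < i)%N -> sylv i = (1 + \prod_(1 <= j < i) sylv j)%N.
Proof. by case: i => [|[|i]] // _; rewrite /sylv /= -sylv_prodE. Qed.

Section Defs.
Variables (R : realType) (d : nat).
Local Notation pt := 'rV[R]_d.

Definition lattice_pt (x : pt) : Prop := exists z : 'rV[int]_d, x = map_mx intr z.

Definition conv (n : nat) (v : 'I_n -> pt) : set pt :=
  [set x | exists l : 'I_n -> R, (forall i, 0 <= l i) /\ \sum_i l i = 1 /\
                                x = \sum_i l i *: v i].

Definition lattice_polytope (P : set pt) : Prop :=
  exists n (v : 'I_n -> pt), (forall i, lattice_pt (v i)) /\ P = conv v.

Definition int_lattice_pt (P : set pt) (x : pt) : Prop :=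
  (@interior pt P) x /\ lattice_pt x.

Definition has_k_int_pts (P : set pt) (k : nat) : Prop :=
  exists s : seq pt, [/\ uniq s, size s = k &
    forall x, int_lattice_pt P x <-> x \in s].

Definition full_dim (P : set pt) : Prop := @interior pt P !=set0.

Definition in_P (k : nat) (P : set pt) : Prop :=
  [/\ lattice_polytope P, full_dim P & has_k_int_pts P k].

Definition aff_indep (n : nat) (v : 'I_n -> pt) : Prop :=
  forall l : 'I_n -> R, \sum_i l i = 0 -> \sum_i l i *: v i = 0 ->
    forall i, l i = 0.

Definition simplex_with_vertices (v : 'I_d.+1 -> pt) (S : set pt) : Prop :=
  aff_indep v /\ S = conv v.

Definition in_S (k : nat) (S : set pt) : Prop :=
  in_P k S /\ exists v : 'I_d.+1 -> pt, simplex_with_vertices v S.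

Definition barycentric (v : 'I_d.+1 -> pt) (x : pt) (b : 'I_d.+1 -> R) : Prop :=
  \sum_i b i = 1 /\ x = \sum_i b i *: v i.

(* Volume, normalized so that vol [0,1]^d = 1: Jordan (inner) content, the
   supremum of the total volume of finite unions of dyadic grid cubes of
   side 2^-n contained in P. *)
Definition dcube (n : nat) (z : 'rV[int]_d) : set pt :=
  [set x | forall i, (z 0 i)%:~R / 2 ^+ n <= x 0 i <= ((z 0 i)%:~R + 1) / 2 ^+ n].

Definition vol (P : set pt) : R :=
  sup [set r : R | exists (n : nat) (s : seq 'rV[int]_d),
        [/\ uniq s, (forall z, z \in s -> dcube n z `<=` P) &
            r = (size s)%:R / 2 ^+ (n * d)]].

End Defs.

(* Main.v *)
(* Part (a). Let x be the interior lattice point of S maximizing its smallest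
   barycentric coordinate mu. If beta are its coordinates and gamma = beta - mu,
   then for every set J of vertices prod_J gamma <= 1 - sum_J beta: otherwise a
   lattice-point argument in the style of Minkowski gives integers z_i (i in J)
   with n = sum z_i > 0 and |z_i - n beta_i| < gamma_i, and
   (n + 1) x - sum z_i v_i would be a better point. Replacing the zero entry of
   gamma by (d+1) mu turns these bounds into the product-sum inequalities that
   are extremal for the Sylvester sequence, so (d+1) mu >= 1 / (s_(d+1) - 1).
   The argument does not need the points v_i to be affinely independent.

   Part (b). Choose a simplex of maximal volume among the generators of P; all
   points of P have barycentric coordinates at most 1 with respect to it. An
   interior lattice point is a positive combination of its d+1 vertices and at
   most d further generators, so the argument of (a) for 2d+1 points yields a
   lattice point y = sum b_i v_i with b_i >= delta := 1/((2d+1)(s_(2d+1) - 1)).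
   Then y + (p - q)/m is interior for p, q interior and 1/m <= delta. If P
   contained too many cubes of a fine grid, k + 1 of the scaled centres would be
   congruent modulo the lattice, giving k + 1 interior lattice points. *)
Require Import Defs.
From HB Require Import structures.
From mathcomp Require Import all_boot all_order all_algebra.
From mathcomp Require Import all_classical all_reals all_analysis.
From mathcomp Require Import zify ring lra.
Import Order.TTheory GRing.Theory Num.Theory.
Import numFieldNormedType.Exports.
Local Open Scope classical_set_scope.
Local Open Scope ring_scope.

Set Implicit Arguments.
Unset Strict Implicit.

Local Notation hull := Defs.conv.

(** * AM-GM and the extremality of the Sylvester sequence *)

Lemma sum_ge_of_prod_ge1 (R : realFieldType) (m : nat) (t : nat -> R) :
  (forall i, (i < m)%N -> 0 <= t i) -> 1 <= \prod_(i < m) t i ->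
  m%:R <= \sum_(i < m) t i.
Proof.
case: m => [|m] t0 h1; first by rewrite big_ord0.
have [//|h _] := @leif_AGM R 'I_m.+1 predT t.
  by move=> i _; exact: t0.
rewrite -[m.+1%:R]mul1r -ler_pdivlMr ?ltr0Sn//.
have s0 : 0 <= \sum_(i < m.+1) t i by apply: sumr_ge0 => i _; exact: t0.
rewrite -(@expr_ge1 _ m.+1)//; last by rewrite divr_ge0.
apply: (le_trans h1); apply: (le_trans h).
by rewrite cardT size_enum_ord.
Qed.

(** AM-GM, applied to the ratios [u i / x i], makes every prefix sum of [a i = u i / x i - 1]
    nonnegative. Weighting by the nonincreasing [x i] keeps the total nonnegative, and
    [x i * a i = u i - x i]. *)
Lemma sum_le_of_prefix_prod_le (R : realFieldType) (m : nat) (x u : nat -> R) :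
  (forall i, (i < m)%N -> 0 < x i) -> (forall i, (i < m)%N -> 0 < u i) ->
  (forall i j, (i <= j < m)%N -> x j <= x i) ->
  (forall j, (j <= m)%N -> \prod_(i < j) x i <= \prod_(i < j) u i) ->
  \sum_(i < m) x i <= \sum_(i < m) u i.
Proof.
move=> x0 u0 xs pxu.
pose a i := u i / x i - 1.
have A0 j : (j <= m)%N -> 0 <= \sum_(i < j) a i.
  move=> jm; rewrite sumrB sumr_const card_ord subr_ge0.
  apply: (@sum_ge_of_prod_ge1 R j (fun i => u i / x i)).
    by move=> i ij; rewrite divr_ge0// ltW ?u0 ?x0 ?(leq_trans ij).
  rewrite prodf_div ler_pdivlMr ?mul1r ?pxu// prodr_gt0// => i _.
  by rewrite x0// (leq_trans _ jm).
(* Abel summation *)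
have key j c : (j <= m)%N -> 0 <= c -> (forall i, (i < j)%N -> c <= x i) ->
    c * \sum_(i < j) a i <= \sum_(i < j) x i * a i.
  elim: j c => [|j IH] c jm c0 cx; first by rewrite !big_ord0 mulr0.
  have h : x j * \sum_(i < j) a i <= \sum_(i < j) x i * a i.
    apply: IH; [exact: ltnW|exact/ltW/x0|].
    by move=> i ij; apply: xs; rewrite (ltnW ij).
  rewrite (le_trans (ler_wpM2r (A0 _ jm) (cx j (ltnSn j))))//.
  by rewrite !big_ord_recr /= mulrDr lerD2r h.
have := key m 0 (leqnn m) (lexx 0) (fun i im => ltW (x0 i im)).
rewrite mul0r -(subr_ge0 (\sum_(i < m) x i)) -sumrB.
move=> h; rewrite (le_trans h)// ler_sum// => i _.
by rewrite /a mulrBr mulr1 mulrCA mulfV ?mulr1 ?gt_eqF ?x0.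
Qed.

Lemma sylv_prod_gt0 n : (0 < sylv_prod n)%N.
Proof. by elim: n => //= n IH; rewrite muln_gt0 IH. Qed.

(** Telescoping, since 1/(p+1) = 1/p - 1/(p(p+1)). Together with [prod_inv_sylv] it shows that the
    Sylvester reciprocals attain equality in every product-sum inequality of [sylvester_sum]. *)
Lemma sum_inv_sylv (R : realFieldType) r :
  \sum_(i < r) ((sylv_prod i).+1%:R)^-1 = 1 - ((sylv_prod r)%:R)^-1 :> R.
Proof.
elim: r => [|r IH]; first by rewrite big_ord0 invr1 subrr.
rewrite big_ord_recr /= IH natrM -[(sylv_prod r).+1%:R]natr1.
have : (0:R) < (sylv_prod r)%:R by rewrite ltr0n sylv_prod_gt0.
set p : R := _%:R => pp; field.
by apply/andP; split; lra.
Qed.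

Lemma prod_inv_sylv (R : realFieldType) r :
  \prod_(i < r) ((sylv_prod i).+1%:R)^-1 = ((sylv_prod r)%:R)^-1 :> R.
Proof.
elim: r => [|r IH]; first by rewrite big_ord0 invr1.
by rewrite big_ord_recr /= IH natrM invfM.
Qed.

(* Soundararajan's argument for the optimality of the Sylvester expansion. *)
Lemma sylvester_sum (R : realFieldType) (r : nat) (x : nat -> R) :
  (forall i, (i < r)%N -> 0 <= x i) ->
  (forall i j, (i <= j < r)%N -> x j <= x i) ->
  (forall j, (j <= r)%N -> \prod_(i < j) x i <= 1 - \sum_(i < j) x i) ->
  \sum_(i < r) x i <= 1 - ((sylv_prod r)%:R)^-1.
Proof.
pose u i : R := ((sylv_prod i).+1%:R)^-1.
have u0 i : 0 < u i by rewrite invr_gt0 ltr0Sn.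
have pu0 m : 0 < \prod_(i < m) u i by apply: prodr_gt0.
rewrite -sum_inv_sylv -/u; elim/ltn_ind: r => [[|r] IH] x0 xs xp.
  by rewrite !big_ord0.
have IHj j : (j <= r)%N -> \sum_(i < j) x i <= \sum_(i < j) u i.
  move=> jr; apply: IH => //.
  - by move=> i ij; apply: x0; lia.
  - by move=> i k ik; apply: xs; lia.
  - by move=> k kj; apply: xp; lia.
have := x0 r (ltnSn r); rewrite le_eqVlt => /predU1P[xr0|xr0].
  by rewrite !big_ord_recr /= -xr0 addr0 (le_trans (IHj r _))// lerDl ltW.
have xpos i : (i < r.+1)%N -> 0 < x i.
  by move=> ir; apply: (lt_le_trans xr0); apply: xs; lia.
have px0 j : (j <= r.+1)%N -> 0 < \prod_(i < j) x i.
  by move=> jr; apply: prodr_gt0 => i _; apply: xpos; apply: leq_trans jr.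
rewrite leNgt; apply/negP => Sgt.
have plt : \prod_(i < r.+1) x i < \prod_(i < r.+1) u i.
  apply: (le_lt_trans (xp _ (leqnn _))).
  by rewrite prod_inv_sylv ltrBlDr addrC -ltrBlDr -sum_inv_sylv.
(* As the sum is too large, [rho r.+1 < 1 = rho 0], so a maximizer [q <= r] of [rho] also beats
   [r.+1]. Induction bounds the first [q] terms; beyond [q] the partial products of [x] stay below
   those of [u], and the rest is bounded by [sum_le_of_prefix_prod_le]. *)
pose rho j := (\prod_(i < j) x i) / (\prod_(i < j) u i).
have [q _ qmax] := @arg_maxP _ R 'I_r.+1 ord0 predT (fun q => rho (val q)) isT.
have rq1 : 1 <= rho q.
  by have := qmax ord0 isT; rewrite /rho /= !big_ord0 divr1.
have rjq j : (j <= r.+1)%N -> rho j <= rho q.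
  rewrite leq_eqVlt => /predU1P[->|jr]; last exact: (qmax (Ordinal jr)).
  by rewrite (le_trans _ rq1)// ler_pdivrMr// mul1r ltW.
have qr : (q + (r.+1 - q) = r.+1)%N by rewrite subnKC// ltnW.
have blk : \sum_(i < r.+1 - q) x (q + i)%N <= \sum_(i < r.+1 - q) u (q + i)%N.
  apply: (@sum_le_of_prefix_prod_le R _ (fun i => x (q + i)%N)
    (fun i => u (q + i)%N)) => //.
  - by move=> i ir; apply: xpos; lia.
  - by move=> i j ij; apply: xs; lia.
  - move=> j jr.
    have qj : (q + j <= r.+1)%N by lia.
    have := rjq _ qj; rewrite /rho !big_split_ord /= => h.
    have := px0 q (ltnW (ltn_ord q)); have := pu0 q.
    move: h.
    have : 0 < \prod_(i < j) u (q + i)%N by apply: prodr_gt0.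
    move: (\prod_(i < q) x i) (\prod_(i < q) u i) => a b.
    move: (\prod_(i < j) u _) (\prod_(i < j) x _) => c d c0 h b0 a0.
    have ab : 0 < a / b by rewrite divr_gt0.
    by move: h; rewrite -mulf_div ger_pMr// ler_pdivrMr// mul1r.
have := lerD (IHj q (ltn_ord q)) blk.
have e (f : nat -> R) : \sum_(i < r.+1) f i =
    \sum_(i < q) f i + \sum_(i < r.+1 - q) f (q + i)%N.
  by rewrite -(big_mkord xpredT f) -{1}qr big_mkord big_split_ord.
by rewrite -(e x) -(e u) leNgt Sgt.
Qed.

(** * Short lattice vectors by pigeonhole *)

Lemma card_ord_below (N c : nat) : (c <= N)%N -> #|[pred x : 'I_N | (x < c)%N]| = c.
Proof.
move=> cN; rewrite -sum1_card.
under eq_bigl do rewrite inE.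
by rewrite (big_ord_narrow cN) sum1_card card_ord.
Qed.

Lemma card_boxed_ffun (n N : nat) (c : 'I_n -> nat) : (forall i, (c i <= N)%N) ->
  #|family (fun i : 'I_n => [pred x : 'I_N | (x < c i)%N])| = (\prod_i c i)%N.
Proof.
move=> cN; rewrite card_family foldrE big_map enumT.
by apply: eq_bigr => i _; rewrite card_ord_below.
Qed.

(* The lattice of all [D z - (\sum z) b], with z supported on J, has index
   D^(|J|-1) (D - B) in Z^J. If a box has more integer points than this, two of
   them are congruent; [f] lists the invariants of a class, where j0 absorbs
   the redundant coordinate. *)
Lemma small_lattice_vector (n : nat) (b g : 'I_n -> nat) (J : {set 'I_n})
    (j0 : 'I_n) (D := (\sum_i b i)%N) (B := (\sum_(i in J) b i)%N) :
  j0 \in J -> (B < D)%N -> (forall i, (g i <= D)%N) ->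
  (D ^ #|J|.-1 * (D - B) < \prod_(i in J) g i)%N ->
  exists z : 'I_n -> int, [/\ forall i, i \notin J -> z i = 0,
    exists i, z i != 0 &
    forall i, i \in J -> `|D%:Z * z i - (\sum_i z i) * (b i)%:Z| < (g i)%:Z].
Proof.
move=> j0J BD gD big.
(* [cg] forces the coordinates outside [J] to be 0; [cf] counts the values of each invariant, with
   product D^(|J|-1) (D - B). *)
pose cg i := if i \in J then g i else 1%N.
pose cf i := if i == j0 then (D - B)%N else if i \in J then D else 1%N.
pose box := family (fun i : 'I_n => [pred x : 'I_D.+1 | (x < cg i)%N]).
pose cls := family (fun i : 'I_n => [pred x : 'I_D.+1 | (x < cf i)%N]).
pose s (w : {ffun 'I_n -> 'I_D.+1}) : nat := (\sum_(i in J) (w i : nat))%N.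
pose q w := (s w %/ (D - B))%N.
pose f (w : {ffun 'I_n -> 'I_D.+1}) : {ffun 'I_n -> 'I_D.+1} :=
  [ffun i => inord (if i == j0 then s w %% (D - B)
     else if i \in J then (w i + q w * b i) %% D else 0)%N].
have D0 : (0 < D)%N by apply: leq_ltn_trans BD.
have DB0 : (0 < D - B)%N by rewrite subn_gt0.
have fE w i : f w i = (if i == j0 then s w %% (D - B)
     else if i \in J then (w i + q w * b i) %% D else 0)%N :> nat.
  rewrite ffunE inordK// ltnS; case: ifP => _.
    by apply: ltnW; apply: (leq_trans (ltn_pmod _ DB0)); rewrite leq_subr.
  by case: ifP => // _; apply: ltnW; rewrite ltn_pmod.
have cardbox : #|box| = (\prod_(i in J) g i)%N.
  rewrite card_boxed_ffun; first by rewrite [RHS]big_mkcond.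
  by move=> i; rewrite /cg; case: ifP => // _; rewrite (leq_trans (gD i)).
have cardcls : #|cls| = (D ^ #|J|.-1 * (D - B))%N.
  rewrite card_boxed_ffun; last first.
    move=> i; rewrite /cf; case: ifP => _; first by rewrite leqW// leq_subr.
    by case: ifP.
  rewrite (bigD1 j0)//= /cf eqxx mulnC; congr (_ * _)%N.
  rewrite (eq_bigr (fun i => if i \in J :\ j0 then D else 1%N)); last first.
    by move=> i /negbTE ij; rewrite ij !inE ij.
  rewrite (cardsD1 j0 J) j0J add1n /= -prod_nat_const.
  rewrite -big_mkcondr; apply: eq_bigl => i; rewrite !inE.
  by case: (i == j0).
have : ~~ dinjectiveb f box.
  apply/negP => /dinjectiveP finj.
  have := card_in_imset finj; have : (#|f @: box| <= #|cls|)%N.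
    apply: subset_leq_card; apply/fintype.subsetP => _ /imsetP[w _ ->].
    apply/familyP => i; rewrite inE fE /cf; case: ifP => _.
      by rewrite ltn_pmod.
    by case: ifP => // _; rewrite ltn_pmod.
  by rewrite cardcls => h1 h2; move: big; rewrite -cardbox -h2 ltnNge h1.
move=> /dinjectivePn[w wbox [w' /andP[/= w'w w'box] ff]].
pose m : int := (q w)%:Z - (q w')%:Z.
pose e i : int := (w i : nat)%:Z - (w' i : nat)%:Z + m * (b i)%:Z.
have sDB v : s v = (q v * (D - B) + s v %% (D - B))%N by rewrite /q -divn_eq.
have rr : (s w %% (D - B) = s w' %% (D - B))%N.
  by have := fE w j0; rewrite ff fE eqxx => ->.
(* Equal remainders at [j0] make the sums of [w] and [w'] over [J] differ by m (D - B); the terms m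
   b_i add m B. *)
have se : \sum_(i in J) e i = m * D%:Z.
  rewrite /e big_split sumrB /= -mulr_sumr.
  have zs (h : 'I_n -> nat) : \sum_(i in J) (h i)%:Z = (\sum_(i in J) h i)%:Z%N.
    by rewrite (big_morph Posz PoszD (erefl _)).
  rewrite !zs -/(s w) -/(s w') (sDB w) (sDB w') rr -/B /m.
  rewrite !PoszD !PoszM -(subzn (ltnW BD)).
  have aux (Q Q' r x y : int) :
    Q * (x - y) + r - (Q' * (x - y) + r) + (Q - Q') * y = (Q - Q') * x by ring.
  exact: aux.
have eD' i : i \in J -> i != j0 -> (D%:Z %| e i)%Z.
  move=> iJ /negbTE ij.
  have := fE w i; rewrite ff fE ij iJ => /esym.
  move=> h; have {}h : (w i + q w * b i)%:Z%N = (w' i + q w' * b i)%:Z%N %[mod D%:Z]%Z.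
    by rewrite !modz_nat h.
  have -> : e i = (w i + q w * b i)%:Z%N - (w' i + q w' * b i)%:Z%N.
    by rewrite /e /m !PoszD !PoszM; ring.
  by rewrite -eqz_mod_dvd; apply/eqP.
(* The invariant at [j0] does not record divisibility there; it follows from the total m D and the
   other entries. *)
have eD i : i \in J -> (D%:Z %| e i)%Z.
  move=> iJ; have [->|] := eqVneq i j0; last exact: eD'.
  have -> : e j0 = m * D%:Z - \sum_(i in J | i != j0) e i.
    by rewrite -se (bigD1 j0)//= addrK.
  rewrite rpredB ?dvdz_mull// rpred_sum// => k /andP[]; exact: eD'.
pose z i := if i \in J then (e i %/ D%:Z)%Z else 0.
have zE i : i \in J -> D%:Z * z i = e i.
  by move=> iJ; rewrite /z iJ mulrC divzK// eD.
have sz : \sum_i z i = m.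
  have Dn0 : D%:Z != 0 by rewrite -lt0n.
  apply: (mulfI Dn0); rewrite [RHS]mulrC -se mulr_sumr.
  rewrite [RHS]big_mkcond /=; apply: eq_bigr => i _.
  by case: ifPn => [/zE//|iJ]; rewrite /z (negbTE iJ) mulr0.
exists z; split.
- by move=> i /negbTE iJ; rewrite /z iJ.
(* If z = 0 then m = 0, so [w] and [w'] agree on [J]; outside [J] both vanish. *)
- apply/existsP; apply: contraNT w'w => /existsPn z0.
  have z0' i : z i = 0 by apply/eqP; have := z0 i; rewrite negbK.
  apply/eqP/ffunP => i; apply: val_inj => /=.
  have [iJ|iJ] := boolP (i \in J).
    have := zE i iJ; rewrite z0' mulr0 /e -sz big1 => [|j _]; last exact: z0'.
    by rewrite mul0r addr0 => /esym/eqP; rewrite subr_eq0 => /eqP[].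
  move/familyP: wbox => /(_ i); move/familyP: w'box => /(_ i).
  by rewrite !inE /cg (negbTE iJ) !ltnS !leqn0 => /eqP -> /eqP ->.
- move=> i iJ; rewrite sz zE// /e addrK.
  move/familyP: wbox => /(_ i); move/familyP: w'box => /(_ i).
  have aux (x y c : nat) : (x < c)%N -> (y < c)%N -> `|x%:Z - y%:Z| < c%:Z by lia.
  by rewrite !inE /cg iJ => h' h; exact: aux.
Qed.

(** * Lattice points with a large smallest weight *)

(** Sorting [a] in decreasing order turns prefixes into subsets. The last term is 0, so only [n]
    terms count and the bound involves [sylv_prod n] rather than [sylv_prod n.+1]. *)
Lemma sylvester_subset_sum (R : realFieldType) (n : nat) (a : 'I_n.+1 -> R) :
  (forall i, 0 <= a i) -> (exists i, a i = 0) ->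
  (forall J : {set 'I_n.+1}, \prod_(i in J) a i <= 1 - \sum_(i in J) a i) ->
  \sum_i a i <= 1 - ((sylv_prod n)%:R)^-1.
Proof.
move=> a0 [i0 ai0] aJ.
pose ge i j := a j <= a i.
pose s := sort ge (enum 'I_n.+1).
have sz : size s = n.+1 by rewrite size_sort size_enum_ord.
have us : uniq s by rewrite sort_uniq enum_uniq.
have sS i : i \in s by rewrite mem_sort mem_enum.
have si i : (index i s < n.+1)%N by have := sS i; rewrite -index_mem sz.
have ss : sorted ge s by apply: sort_sorted => i j; exact: le_total.
pose x i := a (nth ord0 s i).
have xs i j : (i <= j < n.+1)%N -> x j <= x i.
  move=> /andP[ij jn]; apply: (@sorted_leq_nth _ ge) => //.
  - by move=> p q r qp rp; apply: le_trans qp.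
  - by move=> p; exact: lexx.
  - by rewrite inE sz (leq_ltn_trans ij).
  - by rewrite inE sz.
pose J j := [set nth ord0 s (val i) | i in 'I_j]%SET.
have injn j : (j <= n.+1)%N ->
    {in [set: 'I_j]%SET &, injective (fun i : 'I_j => nth ord0 s (val i))}.
  move=> jn i k _ _ /eqP; rewrite nth_uniq ?sz ?(leq_trans (ltn_ord _))//.
  by move=> /eqP /val_inj.
have Jsum j : (j <= n.+1)%N -> \sum_(i in J j) a i = \sum_(i < j) x i.
  move=> jn; rewrite /J big_imset /=; first by apply: eq_bigl => i; rewrite inE.
  by move=> i k _ _; apply: (injn j jn); rewrite inE.
have Jprod j : (j <= n.+1)%N -> \prod_(i in J j) a i = \prod_(i < j) x i.
  move=> jn; rewrite /J big_imset /=; first by apply: eq_bigl => i; rewrite inE.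
  by move=> i k _ _; apply: (injn j jn); rewrite inE.
have xn : x n = 0.
  apply/le_anti; rewrite a0 andbT -ai0 -{1}(nth_index ord0 (sS i0)).
  by apply: xs; rewrite ltnSn andbT -ltnS si.
have JT : J n.+1 = [set: 'I_n.+1]%SET.
  apply/setP => i; rewrite inE; apply/imsetP.
  by exists (Ordinal (si i)); rewrite //= nth_index.
have -> : \sum_i a i = \sum_(i < n) x i.
  transitivity (\sum_(i < n.+1) x i); last by rewrite big_ord_recr /= xn addr0.
  by rewrite -(Jsum _ (leqnn _)) JT; apply: eq_bigl => i; rewrite inE.
apply: sylvester_sum => [i _|i j ij|j jn]; first exact: a0.
  by apply: xs; lia.
by rewrite -Jprod -?Jsum ?aJ// ltnW.
Qed.

(** The weights are integer numerators over one fixed denominator [D]. This bounds them, so a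
    largest possible smallest weight [c] exists. A violated product-sum inequality for [g = b - c]
    would yield weights all above [c]. *)
Lemma large_min_coords (n d : nat) (v : 'I_n.+1 -> 'rV[int]_d)
    (b0 : 'I_n.+1 -> nat) (D : nat) :
  (\sum_i b0 i)%N = D -> (forall i, 0 < b0 i)%N ->
  (exists y, \sum_i (b0 i)%:Z *: v i = D%:Z *: y) ->
  exists b : 'I_n.+1 -> nat, [/\ (\sum_i b i)%N = D,
    exists y, \sum_i (b i)%:Z *: v i = D%:Z *: y &
    forall i, (D <= n.+1 * sylv_prod n * b i)%N].
Proof.
move=> sb0 b0_gt0 b0_lat.
pose good (b : 'I_n.+1 -> nat) := (\sum_i b i)%N = D /\
  exists y, \sum_i (b i)%:Z *: v i = D%:Z *: y.
pose P c := `[< exists2 b, good b & forall i, (c <= b i)%N >].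
have exP : exists c, P c by exists 1%N; apply/asboolP; exists b0.
have bD b i : good b -> (b i <= D)%N.
  by move=> [<- _]; rewrite (bigD1 i)//= leq_addr.
have PD c : P c -> (c <= D)%N.
  by move=> /asboolP[b gb cb]; rewrite (leq_trans (cb ord0))// bD.
have [c /asboolP[b gb cb] cmax] := ex_maxnP exP PD.
have c0 : (0 < c)%N by apply: cmax; apply/asboolP; exists b0.
have noimp b' : good b' -> ~ forall i, (c < b' i)%N.
  move=> gb' cb'; have /cmax : P c.+1 by apply/asboolP; exists b'.
  by rewrite ltnn.
pose g i := (b i - c)%N.
have bE i : b i = (g i + c)%N by rewrite /g subnK.
have b_gt0 i : (0 < b i)%N by rewrite (leq_trans c0).
have [sb lb] := gb.
have D0 : (0 < D)%N by rewrite (leq_trans (b_gt0 ord0))// bD.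
have gle i : (g i <= D)%N by rewrite (leq_trans (leq_subr _ _))// bD.
have key (J : {set 'I_n.+1}) j0 : j0 \in J -> (\sum_(i in J) b i < D)%N ->
    (\prod_(i in J) g i <= D ^ #|J|.-1 * (D - \sum_(i in J) b i))%N.
  move=> j0J BD; rewrite leqNgt; apply/negP => big.
  have := @small_lattice_vector _ b g J j0; rewrite sb.
  move=> /(_ j0J BD gle big)[z0 [z0J [k z0k] z0b]].
  (* The conditions are invariant under negation, so the sum may be taken nonnegative. *)
  have [z [zJ zk zb m0]] : exists z : 'I_n.+1 -> int, [/\
      forall i, i \notin J -> z i = 0, z k != 0,
      forall i, i \in J -> `|D%:Z * z i - (\sum_i z i) * (b i)%:Z| < (g i)%:Z
      & 0 <= \sum_i z i].
    have [m0|m0] := leP 0 (\sum_i z0 i); first by exists z0.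
    exists (fun i => - z0 i); split.
    - by move=> i iJ; rewrite z0J ?oppr0.
    - by rewrite oppr_eq0.
    - by move=> i iJ; rewrite sumrN mulrN mulNr -opprB opprK addrC normrN z0b.
    - by rewrite sumrN oppr_ge0 ltW.
  pose m := \sum_i z i; rewrite -/m in zb m0.
  (* A zero sum would give D |z_k| < g_k <= D with z_k nonzero. *)
  have m_gt0 : 0 < m.
    rewrite lt_def m0 andbT; apply/eqP => m00.
    have kJ : k \in J by apply: contraNT zk => /zJ ->.
    have := zb k kJ; rewrite m00 mul0r subr0 normrM ltNge => /negP; apply.
    apply: (@le_trans _ _ (D%:Z * 1)); first by rewrite mulr1 lez_nat.
    by rewrite ler_pM//; move: zk; lia.
  (* Numerators of (m + 1) x - sum z_i v_i. On [J] they exceed [c] because D z_i - m b_i < b_i - c;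
     off [J] because z_i = 0, m >= 1 and c > 0. *)
  pose e i : int := (b i)%:Z + (m * (b i)%:Z - D%:Z * z i).
  have ec i : c%:Z < e i.
    rewrite /e; have [iJ|iJ] := boolP (i \in J).
      by have := zb i iJ; rewrite bE PoszD; lia.
    rewrite zJ// mulr0 subr0.
    have : 1 * (b i)%:Z <= m * (b i)%:Z by rewrite ler_wpM2r.
    by have := cb i; lia.
  pose b' i := `|e i|%N.
  have b'E i : (b' i)%:Z = e i by have := ec i; rewrite /b'; lia.
  apply: (noimp b'); last by move=> i; have := ec i; rewrite -b'E; lia.
  split.
    apply/eqP; rewrite -eqz_nat (big_morph Posz PoszD (erefl _)).
    under eq_bigr do rewrite b'E /e.
    rewrite big_split sumrB /= -!mulr_sumr -/m.
    by rewrite -(big_morph Posz PoszD (erefl _)) sb mulrC subrr addr0.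
  have [y yE] := lb.
  exists (y + m *: y - \sum_i z i *: v i).
  under eq_bigr do rewrite b'E /e scalerDl scalerBl -!scalerA.
  rewrite big_split sumrB /= -!scaler_sumr yE scalerBr scalerDr.
  by rewrite !scalerA [m * _]mulrC addrA.
have [i0 gi0] : exists i, g i = 0%N.
  apply: contrapT => /forallNP gn0; apply: (noimp b) => // i.
  by rewrite bE -[X in (X < _)%N]add0n ltn_add2r lt0n; apply/eqP.
have DR : (0:rat) < D%:R by rewrite ltr0n.
have sgD : (\sum_i g i + n.+1 * c = D)%N.
  rewrite -sb [RHS](eq_bigr (fun i => g i + c)%N); last by move=> i _; exact: bE.
  by rewrite big_split /= sum_nat_const card_ord.
pose a i : rat := (g i)%:R / D%:R.
have sa (J : {set 'I_n.+1}) : \sum_(i in J) a i = (\sum_(i in J) g i)%:R / D%:R.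
  by rewrite -mulr_suml natr_sum.
have aJ (J : {set 'I_n.+1}) : \prod_(i in J) a i <= 1 - \sum_(i in J) a i.
  have [->|[j0 j0J]] := set_0Vmem J; first by rewrite !big_set0 subr0.
  have [BD|BD] := ltnP (\sum_(i in J) b i)%N D.
    have J0 : #|J| = #|J|.-1.+1 by rewrite prednK// card_gt0; apply/set0Pn; exists j0.
    apply: (@le_trans _ _ (1 - (\sum_(i in J) b i)%:R / D%:R)); last first.
      rewrite lerD2l lerN2 sa ler_pM2r ?invr_gt0// ler_nat leq_sum// => i _.
      by rewrite leq_subr.
    rewrite prodf_div prodr_const -natr_prod J0 exprS.
    rewrite ler_pdivrMr ?mulr_gt0 ?exprn_gt0//.
    apply: (@le_trans _ _ (D ^ #|J|.-1 * (D - \sum_(i in J) b i))%:R).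
      by rewrite ler_nat (key J j0).
    rewrite natrM natrX (natrB _ (ltnW BD)).
    have aux (x y p : rat) : 0 < x -> p * (x - y) <= (1 - y / x) * (x * p).
      move=> x0; rewrite [leRHS](_ : _ = p * (x - y))//.
      by field; rewrite gt_eqF.
    exact: aux.
  (* All weights are positive, so a sum of at least [D] forces [i0] into [J], and the factor
     [a i0 = 0] kills the product. *)
  have i0J : i0 \in J.
    apply: contraLR BD => i0J; rewrite -ltnNge -sb [X in (_ < X)%N](bigID (mem J))/=.
    by rewrite -[X in (X < _)%N]addn0 ltn_add2l (bigD1 i0)//= addn_gt0 b_gt0.
  have ai0 : a i0 = 0 by rewrite /a gi0 mul0r.
  rewrite (bigD1 i0)//= ai0 mul0r subr_ge0 sa.
  rewrite ler_pdivrMr// mul1r ler_nat -sgD (leq_trans _ (leq_addr _ _))//.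
  by rewrite [leqRHS](bigID (mem J))/= leq_addr.
exists b; split => // i.
have : \sum_i a i <= 1 - ((sylv_prod n)%:R)^-1.
  apply: sylvester_subset_sum => //; first by move=> j; rewrite divr_ge0.
  by exists i0; rewrite /a gi0 mul0r.
have p0 : (0:rat) < (sylv_prod n)%:R.
  by rewrite ltr0n sylv_prod_gt0.
have sgR : D%:R = (\sum_i g i)%:R + (n.+1 * c)%:R :> rat by rewrite -sgD natrD.
(* As sum g = D - (n + 1) c, the bound becomes (n + 1) c >= D / [sylv_prod n]. *)
rewrite -mulr_suml -natr_sum ler_pdivrMr// mulrBl mul1r lerBrDr [in leRHS]sgR.
rewrite lerD2l mulrC ler_pdivrMr// -natrM ler_nat => h.
by rewrite (leq_trans h)// mulnAC leq_mul.
Qed.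

(** * Convex hulls and their interiors *)

Lemma interior_rowP (R : realType) (d : nat) (P : set 'rV[R]_d) (x : 'rV[R]_d) :
  (@interior 'rV[R]_d P) x <->
  exists2 e : R, 0 < e &
    forall y : 'rV[R]_d, (forall j, `|x 0 j - y 0 j| < e) -> P y.
Proof.
split=> [/nbhs_ballP[e /= e0 h]|[e e0 h]].
  by exists e => // y xy; apply: h; split=> // i j; rewrite ord1; exact: xy.
apply/nbhs_ballP; exists e => //= y [_ xy]; apply: h => j; exact: xy.
Qed.

Lemma hull_comb (R : realType) (d N m : nat) (w : 'I_N -> 'rV[R]_d)
    (u : 'I_m -> 'rV[R]_d) (c : 'I_m -> R) :
  (forall i, hull w (u i)) -> (forall i, 0 <= c i) -> \sum_i c i = 1 ->
  hull w (\sum_i c i *: u i).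
Proof.
move=> wu c0 c1; have [l lP] := choice wu.
exists (fun j => \sum_i c i * l i j); split; last split.
- move=> j; apply: sumr_ge0 => i _; apply: mulr_ge0 => //.
  by have [] := lP i.
- rewrite exchange_big -c1 /=; apply: eq_bigr => i _.
  by rewrite -mulr_sumr; have [_ [-> _]] := lP i; rewrite mulr1.
- under [RHS]eq_bigr do rewrite scaler_suml.
  rewrite exchange_big /=; apply: eq_bigr => i _.
  have [_ [_ {1}->]] := lP i; rewrite scaler_sumr.
  by apply: eq_bigr => j _; rewrite scalerA.
Qed.

Lemma hull_vertex (R : realType) (d N : nat) (w : 'I_N -> 'rV[R]_d) j : hull w (w j).
Proof.
exists (fun i => (i == j)%:R); split; first by move=> i; rewrite ler0n.
split; first by rewrite (bigD1 j)//= eqxx big1 ?addr0// => i /negbTE ->.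
by rewrite (bigD1 j)//= eqxx scale1r big1 ?addr0// => i /negbTE ->; rewrite scale0r.
Qed.

Lemma hull_segment (R : realType) (d N : nat) (w : 'I_N -> 'rV[R]_d) p q (t : R) :
  hull w p -> hull w q -> 0 <= t <= 1 -> hull w (t *: p + (1 - t) *: q).
Proof.
move=> wp wq /andP[t0 t1].
have := @hull_comb R d N 2 w (fun i => if i == 0 then p else q)
  (fun i => if i == 0 then t else 1 - t).
rewrite !big_ord_recl !big_ord0 /= !addr0; apply.
- by move=> i; case: ifP.
- by move=> i; case: ifP; rewrite ?subr_ge0.
- by rewrite addrC subrK.
Qed.

(** The homothety with centre [q] and ratio [t] carries a neighbourhood of [p] in the hull to a
    neighbourhood of the point on the segment. *)
Lemma interior_segment (R : realType) (d N : nat) (w : 'I_N -> 'rV[R]_d) p q (t : R) :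
  (@interior 'rV[R]_d (hull w)) p -> hull w q -> 0 < t <= 1 ->
  (@interior 'rV[R]_d (hull w)) (t *: p + (1 - t) *: q).
Proof.
move=> /interior_rowP[e e0 h] wq /andP[t0 t1]; apply/interior_rowP.
exists (t * e); first exact: mulr_gt0.
move=> y; set z := _ + _ => zy.
pose p' := p + t^-1 *: (y - z).
have -> : y = t *: p' + (1 - t) *: q.
  rewrite /p' scalerDr scalerA mulfV ?gt_eqF// scale1r addrAC.
  by rewrite -/z addrC subrK.
apply: hull_segment => //; last by rewrite ltW.
apply: h => j.
have aux (a b c : 'rV[R]_d) (s : R) :
    a 0 j - (a + s *: (b - c)) 0 j = s * (c 0 j - b 0 j).
  by rewrite !mxE; ring.
rewrite /p' aux.
by rewrite normrM gtr0_norm ?invr_gt0// mulrC ltr_pdivrMr// mulrC.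
Qed.

Lemma interior_extend (R : realType) (d : nat) (P : set 'rV[R]_d) (p c : 'rV[R]_d) :
  (@interior 'rV[R]_d P) p -> exists2 e : R, 0 < e & P (p + e *: (p - c)).
Proof.
move=> /interior_rowP[e e0 h].
(* [S] exceeds every coordinate distance, and the summand 1 keeps it positive when p = c. *)
pose S := 1 + \sum_j `|p 0 j - c 0 j|.
have S0 : 0 < S by rewrite ltr_pwDl// sumr_ge0.
exists (e / S); first exact: divr_gt0.
apply: h => j; rewrite !mxE opprD addNKr normrN normrM gtr0_norm ?divr_gt0//.
rewrite mulrAC ltr_pdivrMr// ltr_pM2l// /S (bigD1 j)//=.
by rewrite addrCA ltrDl ltr_pwDl// sumr_ge0.
Qed.

(** * Homogeneous and barycentric coordinates *)

(** The leading 1 turns affine relations into linear ones, so that barycentric coordinates solve one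
    square linear system. *)
Definition homog (K : pzRingType) (d : nat) (x : 'rV[K]_d) : 'rV[K]_(1 + d) :=
  row_mx 1%:M x.

Definition homog_mx (K : pzRingType) (m d : nat) (v : 'I_m -> 'rV[K]_d) :
  'M[K]_(m, 1 + d) := \matrix_(i < m) homog (v i).

Lemma mul_homog_mx (K : pzRingType) (m d : nat) (v : 'I_m -> 'rV[K]_d) (l : 'rV[K]_m) :
  l *m homog_mx v = row_mx (\sum_i l 0 i)%:M (\sum_i l 0 i *: v i).
Proof.
apply/rowP => j; rewrite !mxE.
under eq_bigr do rewrite /homog !mxE.
case: splitP => k _.
  by rewrite ord1 [RHS]mxE mulr1n; apply: eq_bigr => i _; rewrite mxE mulr1.
by rewrite summxE; apply: eq_bigr => i _; rewrite [RHS]mxE.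
Qed.

Lemma mul_homog_mxE (K : pzRingType) (m d : nat) (v : 'I_m -> 'rV[K]_d)
    (l : 'rV[K]_m) (x : 'rV[K]_d) :
  l *m homog_mx v = homog x <-> \sum_i l 0 i = 1 /\ \sum_i l 0 i *: v i = x.
Proof.
rewrite mul_homog_mx; split=> [/eq_row_mx[/matrixP/(_ 0 0)]|[-> ->]//].
by rewrite !mxE !mulr1n.
Qed.

Lemma map_homog_mx (R : realType) (m d : nat) (z : 'I_m -> 'rV[int]_d) :
  homog_mx (fun i => map_mx intr (z i)) = map_mx (intr : int -> R) (homog_mx z).
Proof.
apply/matrixP => i j; rewrite /homog !mxE.
by case: splitP => k _; rewrite !mxE// ord1.
Qed.

Lemma aff_indep_unit (R : realType) (d : nat) (v : 'I_(1 + d) -> 'rV[R]_d) :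
  aff_indep v -> homog_mx v \in unitmx.
Proof.
move=> vi; rewrite -row_free_unit; apply: inj_row_free => l.
rewrite mul_homog_mx => e.
have [] := eq_row_mx (etrans e (esym (@row_mx0 _ 1 1 d))) => /matrixP/(_ 0 0).
rewrite !mxE mulr1n => l0 lv0; apply/rowP => i; rewrite mxE.
exact: (vi (fun i => l 0 i)).
Qed.

(** Meaningful only for an invertible matrix: otherwise [invmx] returns its argument. *)
Definition bary (R : realType) (d : nat) (v : 'I_(1 + d) -> 'rV[R]_d)
  (x : 'rV[R]_d) : 'rV[R]_(1 + d) := homog x *m invmx (homog_mx v).

Section Bary.
Variables (R : realType) (d : nat) (v : 'I_(1 + d) -> 'rV[R]_d).
Hypothesis v_unit : homog_mx v \in unitmx.

Lemma baryP x : \sum_i bary v x 0 i = 1 /\ \sum_i bary v x 0 i *: v i = x.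
Proof. by apply/mul_homog_mxE; rewrite mulmxKV. Qed.

Lemma bary_uniq x (l : 'I_(1 + d) -> R) :
  \sum_i l i = 1 -> \sum_i l i *: v i = x -> forall i, bary v x 0 i = l i.
Proof.
move=> l1 lv i.
have : (\row_i l i) *m homog_mx v = homog x.
  by apply/mul_homog_mxE; split; [rewrite -l1|rewrite -lv];
    apply: eq_bigr => j _; rewrite mxE.
by rewrite /bary => <-; rewrite mulmxK// mxE.
Qed.

Lemma bary_comb (m : nat) (u : 'I_m -> 'rV[R]_d) (c : 'I_m -> R) i :
  \sum_j c j = 1 ->
  bary v (\sum_j c j *: u j) 0 i = \sum_j c j * bary v (u j) 0 i.
Proof.
move=> c1; apply: (bary_uniq (l := fun i => \sum_j c j * bary v (u j) 0 i)).
  rewrite exchange_big -c1 /=; apply: eq_bigr => j _.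
  by rewrite -mulr_sumr; have [-> _] := baryP (u j); rewrite mulr1.
under eq_bigr do rewrite scaler_suml.
rewrite exchange_big /=; apply: eq_bigr => j _.
have [_ {2}<-] := baryP (u j); rewrite scaler_sumr.
by apply: eq_bigr => k _; rewrite scalerA.
Qed.

Lemma bary_segment x y (t : R) i :
  bary v (t *: x + (1 - t) *: y) 0 i = t * bary v x 0 i + (1 - t) * bary v y 0 i.
Proof.
rewrite /bary -[RHS](_ : (t *: bary v x + (1 - t) *: bary v y) 0 i = _); last first.
  by rewrite !mxE.
congr (_ 0 i); rewrite /bary !scalemxAl -mulmxDl; congr (_ *m _).
rewrite /homog !scale_row_mx add_row_mx; congr row_mx.
by rewrite -scalerDl addrC subrK scale1r.
Qed.

Lemma hull_bary x : hull v x <-> forall i, 0 <= bary v x 0 i.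
Proof.
split=> [[l [l0 [l1 ->]]] i|h]; first by rewrite (bary_uniq l1 (erefl _)).
by exists (fun i => bary v x 0 i); have [? ?] := baryP x.
Qed.

(** Pushing [x] slightly away from [v i] stays in the simplex and changes its coordinate beta at [i]
    to (1 + e) beta - e, which must be nonnegative. *)
Lemma interior_bary_gt0 x i :
  (@interior 'rV[R]_d (hull v)) x -> 0 < bary v x 0 i.
Proof.
move=> /(interior_extend (v i))[e e0 /hull_bary/(_ i)].
have -> : x + e *: (x - v i) = (1 + e) *: x + (1 - (1 + e)) *: v i.
  have -> : 1 - (1 + e) = - e by ring.
  by rewrite scaleNr scalerBr scalerDl scale1r addrA.
rewrite bary_segment (_ : bary v (v i) 0 i = 1); last first.
  rewrite (@bary_uniq _ (fun j => (j == i)%:R)) ?eqxx//.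
    by rewrite (bigD1 i)//= eqxx big1 ?addr0// => j /negbTE ->.
  by rewrite (bigD1 i)//= eqxx scale1r big1 ?addr0// => j /negbTE ->; rewrite scale0r.
move=> h; have : 0 < (1 + e) * bary v x 0 i by lra.
by rewrite pmulr_rgt0 ?ltr_pwDl// ltW.
Qed.

Lemma bary_gt0_interior x p : (@interior 'rV[R]_d (hull v)) p ->
  (forall i, 0 < bary v x 0 i) -> (@interior 'rV[R]_d (hull v)) x.
Proof.
move=> vp xpos.
have vp' : hull v p by exact: interior_subset vp.
have bp0 := (hull_bary p).1 vp'.
have bp1 i : bary v p 0 i <= 1.
  have [<- _] := baryP p; rewrite (bigD1 i)//= lerDl sumr_ge0//.
(* Half the smallest coordinate of [x], capped so that [t < 1]. Coordinates of [p] are at most 1, so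
   removing [t *: p] from [x] leaves nonnegative weights: [x] lies on a segment from [p] to a point
   [q] of the simplex. *)
pose t := (\big[Order.min/1]_i bary v x 0 i) / 2.
have m0 : 0 < \big[Order.min/1]_i bary v x 0 i.
  by apply: lt_bigmin.
have t0 : 0 < t by rewrite divr_gt0.
have m1 : \big[Order.min/1]_i bary v x 0 i <= 1 by exact: bigmin_le_id.
have t1 : t < 1 by rewrite /t; lra.
have tx i : t <= bary v x 0 i.
  have : \big[Order.min/1]_i bary v x 0 i <= bary v x 0 i by exact: bigmin_le.
  by rewrite /t; have := m0; lra.
pose q := (1 - t)^-1 *: x + (1 - (1 - t)^-1) *: p.
have t1' : 1 - t != 0 by lra.
have -> : x = t *: p + (1 - t) *: q.
  rewrite /q scalerDr !scalerA mulfV// scale1r addrCA -scalerDl.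
  have -> : t + (1 - t) * (1 - (1 - t)^-1) = 0 by field.
  by rewrite scale0r addr0.
apply: interior_segment; rewrite ?t0 ?ltW//.
apply/hull_bary => i; rewrite /q bary_segment.
rewrite [leRHS](_ : _ = (bary v x 0 i - t * bary v p 0 i) / (1 - t)); last by field.
apply: divr_ge0; rewrite subr_ge0; last exact: ltW.
by rewrite (le_trans _ (tx i))// ler_piMr// ltW.
Qed.

End Bary.

(** * Integrality, and part (a) *)

(** Cramer's rule: the adjugate is integral, so |det A| is a common denominator; the sign is
    absorbed into [c]. *)
Lemma intr_invmx (R : realType) (n : nat) (A : 'M[int]_n) (r : 'rV[int]_n) :
  map_mx (intr : int -> R) A \in unitmx ->
  (0 < `|\det A|)%N /\ exists c : 'rV[int]_n,
    map_mx intr r *m invmx (map_mx intr A) = (`|\det A|%:R : R)^-1 *: map_mx intr c.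
Proof.
move=> uA; have : (\det A)%:~R != 0 :> R by rewrite -det_map_mx -unitfE -unitmxE.
rewrite intr_eq0 => d0; split; first by rewrite absz_gt0.
have dE : (`|\det A|)%:R = `|(\det A)%:~R| :> R by rewrite -intr_norm -abszE.
have rA : map_mx intr r *m invmx (map_mx intr A) =
    ((\det A)%:~R : R)^-1 *: map_mx intr (r *m \adj A).
  by rewrite /invmx uA -map_mx_adj det_map_mx -scalemxAr -map_mxM.
have [dA|dA] := leP 0 (\det A).
  by exists (r *m \adj A); rewrite rA dE ger0_norm// ler0z.
exists (- (r *m \adj A)).
by rewrite rA dE ltr0_norm ?ltrz0// map_mxN scalerN invrN scaleNr opprK.
Qed.

(** The lattice generators [w] may differ from [v], but [v i] is extreme: a generator with positive
    weight in it has barycentric coordinate 1 at [i], hence equals [v i]. *)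
Lemma simplex_lattice_vertices (R : realType) (d : nat) (v : 'I_(1 + d) -> 'rV[R]_d) :
  homog_mx v \in unitmx -> lattice_polytope (hull v) -> forall i, lattice_pt (v i).
Proof.
move=> uv [n [w [wl vw]]] i.
have wv j : hull v (w j) by rewrite vw; exact: hull_vertex.
have [l [l0 [l1 lv]]] : hull w (v i) by rewrite -vw; exact: hull_vertex.
have b0 j k : 0 <= bary v (w j) 0 k by apply: (hull_bary uv (w j)).1.
have bs j : \sum_k bary v (w j) 0 k = 1 by have [] := baryP uv (w j).
have b1 j : bary v (w j) 0 i <= 1.
  by rewrite -(bs j) (bigD1 i)//= lerDl sumr_ge0.
have vi1 : bary v (v i) 0 i = 1.
  rewrite (@bary_uniq _ _ _ uv _ (fun j => (j == i)%:R)) ?eqxx//.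
    by rewrite (bigD1 i)//= eqxx big1 ?addr0// => j /negbTE ->.
  by rewrite (bigD1 i)//= eqxx scale1r big1 ?addr0// => j /negbTE ->; rewrite scale0r.
have [j lj] : exists j, 0 < l j.
  apply: contrapT => /forallNP nl.
  suff : \sum_j l j = 0 by rewrite l1 => /eqP; rewrite oner_eq0.
  rewrite big1// => j _; apply/le_anti; rewrite l0 andbT leNgt; exact/negP.
have bj : bary v (w j) 0 i = 1.
  have : \sum_j l j * (1 - bary v (w j) 0 i) = 0.
    under eq_bigr do rewrite mulrBr mulr1.
    by rewrite sumrB l1 -(bary_comb uv w i l1) -lv vi1 subrr.
  move=> /eqP; rewrite psumr_eq0; last by move=> k _; rewrite mulr_ge0// subr_ge0.
  move=> /allP /(_ j); rewrite mem_index_enum => /(_ isT) /=.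
  by rewrite mulf_eq0 gt_eqF//= subr_eq0 => /eqP.
have -> : v i = w j; last exact: wl.
have [_ <-] := baryP uv (w j).
have bz k : k != i -> bary v (w j) 0 k = 0.
  move=> ki; have := bs j; rewrite (bigD1 i)//= bj => /(canRL (addKr _)).
  rewrite addNr => /eqP; rewrite psumr_eq0 => [/allP/(_ k)|//].
  by rewrite mem_index_enum ki => /(_ isT) /eqP.
by rewrite (bigD1 i)//= bj scale1r big1 ?addr0// => k /bz ->; rewrite scale0r.
Qed.

Lemma map_intr_inj (R : realType) (m n : nat) :
  injective (map_mx intr : 'M[int]_(m, n) -> 'M[R]_(m, n)).
Proof.
move=> A B /matrixP AB; apply/matrixP => i j; have := AB i j.
by rewrite !mxE; exact: intr_inj.
Qed.

Lemma map_intr_lincomb (R : realType) (m d : nat) (b : 'I_m -> nat)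
    (z : 'I_m -> 'rV[int]_d) :
  map_mx intr (\sum_i (b i)%:Z *: z i) =
  \sum_i (b i)%:R *: map_mx intr (z i) :> 'rV[R]_d.
Proof. by rewrite raddf_sum; apply: eq_bigr => i _; rewrite /= map_mxZ. Qed.

(** Cramer's rule writes the coordinates of some interior lattice point over a common denominator
    [D], which gives [large_min_coords] its starting weights. *)
Lemma simplex_deep_point (R : realType) (d k : nat) (S : set 'rV[R]_d)
    (v : 'I_d.+1 -> 'rV[R]_d) :
  (0 < k)%N -> in_S k S -> simplex_with_vertices v S ->
  exists x : 'rV[R]_d, int_lattice_pt S x /\
    exists b : 'I_d.+1 -> R, barycentric v x b /\
      forall i, ((d.+1 * sylv_prod d)%:R)^-1 <= b i.
Proof.
move=> k0 [[Sl _ [s [_ sk sP]]] _] [vi SE]; rewrite SE in Sl sP *.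
have uv := aff_indep_unit vi.
have [z zE] := choice (simplex_lattice_vertices uv Sl).
have {zE}vE : v = fun i => map_mx intr (z i) by apply/funext.
have [x0 [x0i [y0 y0E]]] : exists x, int_lattice_pt (hull v) x.
  case: s sk sP => [sk|x s _ sP]; first by rewrite -sk in k0.
  by exists x; apply/sP; rewrite mem_head.
have := @intr_invmx R _ (homog_mx z) (homog y0).
rewrite -map_homog_mx -vE => /(_ uv)[]; set D := `|_|%N => D0 [c cE].
have DR : (0 : R) < D%:R by rewrite ltr0n.
have bE i : bary v x0 0 i = (c 0 i)%:~R / D%:R.
  have -> : bary v x0 = D%:R^-1 *: map_mx intr c.
    by rewrite -cE /bary y0E /homog map_row_mx map_mx1.
  by rewrite !mxE mulrC.
have c0 i : 0 < c 0 i.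
  have := interior_bary_gt0 uv i x0i.
  by rewrite bE pmulr_lgt0 ?invr_gt0// ltr0z.
pose b0 (i : 'I_d.+1) := `|c 0%R i|%N.
have b0E i : (b0 i)%:Z = c 0 i by rewrite /b0 gez0_abs// ltW.
have b0R i : (b0 i)%:R = D%:R * bary v x0 0 i.
  by rewrite bE mulrC divfK ?gt_eqF// -b0E.
have [bs bv] := baryP uv x0.
have [|||b [bD [y yE] bmin]] := @large_min_coords d d z b0 D.
- by apply/eqP; rewrite -(@eqr_nat R) natr_sum; under eq_bigr do rewrite b0R;
    rewrite -mulr_sumr bs mulr1.
- by move=> i; rewrite /b0 absz_gt0 gt_eqF.
- exists y0; apply/(@map_intr_inj R); rewrite map_mxZ map_intr_lincomb.
  rewrite -y0E -[in RHS]bv scaler_sumr; apply: eq_bigr => i _.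
  by rewrite scalerA -b0R vE.
pose x := map_mx (intr : int -> R) y.
have bDR i : bary v x 0 i = (b i)%:R / D%:R.
  apply: (bary_uniq uv (l := fun i => (b i)%:R / D%:R)).
    by rewrite -mulr_suml -natr_sum bD mulfV ?gt_eqF.
  under eq_bigr do rewrite mulrC -scalerA.
  rewrite -scaler_sumr vE -map_intr_lincomb yE map_mxZ scalerA.
  by rewrite mulVf ?scale1r// gt_eqF.
have p0 := sylv_prod_gt0 d.
have bge i : ((d.+1 * sylv_prod d)%:R)^-1 <= bary v x 0 i.
  rewrite bDR ler_pdivlMr// mulrC ler_pdivrMr ?ltr0n ?muln_gt0//.
  by rewrite -natrM ler_nat mulnC.
exists x; split.
  split; last by exists y.
  apply: (bary_gt0_interior uv x0i) => i; apply: lt_le_trans (bge i).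
  by rewrite invr_gt0 ltr0n muln_gt0.
exists (fun i => bary v x 0 i); split => //.
by have [? ?] := baryP uv x.
Qed.

(** * Simplices of maximal volume *)

(** The cofactors of a row do not involve that row, so expansion along row [i] gives Cramer's
    formula: barycentric coordinates are ratios of signed volumes. *)
Lemma det_replace_vertex (R : realType) (d : nat) (v : 'I_(1 + d) -> 'rV[R]_d) x i :
  homog_mx v \in unitmx ->
  \det (homog_mx (fun k => if k == i then x else v k)) =
  bary v x 0 i * \det (homog_mx v).
Proof.
move=> uv; rewrite (expand_det_row _ i).
rewrite /bary /invmx uv -scalemxAr mxE mulrC mulrA divff -?unitfE -?unitmxE// mul1r.
rewrite mxE; apply: eq_bigr => k _; rewrite !mxE eqxx; congr (_ * _).
rewrite /cofactor; congr (_ * \det _); apply/matrixP => a b; rewrite !mxE.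
by rewrite eq_sym (negbTE (neq_lift i a)).
Qed.

(** A vector orthogonal to the homogenized generators is orthogonal to the whole hull and, by
    extending from an interior point away from any [c], to every [homog c]; so it is 0. *)
Lemma full_dim_row_full (R : realType) (d N : nat) (w : 'I_N -> 'rV[R]_d) :
  full_dim (hull w) -> row_full (homog_mx w).
Proof.
move=> [p pint].
rewrite /row_full -mxrank_tr; apply: inj_row_free => u uA.
have Au : homog_mx w *m u^T = 0 by rewrite -[homog_mx w]trmxK -trmx_mul uA trmx0.
have hullu q : hull w q -> homog q *m u^T = 0.
  move=> [l [_ [l1 lq]]].
  have <- : (\row_i l i) *m homog_mx w = homog q.
    by apply/mul_homog_mxE; split; [rewrite -l1|rewrite lq];
      apply: eq_bigr => j _; rewrite mxE.
  by rewrite -mulmxA Au mulmx0.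
have allu c : homog c *m u^T = 0.
  have [e e0 /hullu] := interior_extend c pint.
  have -> : homog (p + e *: (p - c)) = homog p + e *: (homog p - homog c).
    rewrite /homog opp_row_mx add_row_mx scale_row_mx add_row_mx subrr scaler0.
    by rewrite addr0.
  rewrite mulmxDl -scalemxAl mulmxBl (hullu p (interior_subset pint)) add0r sub0r.
  by rewrite scalerN => /eqP; rewrite oppr_eq0 scaler_eq0 gt_eqF//= => /eqP.
have u0 : lsubmx u = 0.
  have := allu 0; rewrite -[u]hsubmxK tr_row_mx mul_row_col mul1mx mul0mx addr0.
  by rewrite row_mxKl => /(congr1 trmx); rewrite trmxK trmx0.
have u1 : rsubmx u = 0.
  apply/rowP => k; rewrite mxE.
  have := allu (delta_mx 0 k); rewrite -[u in u^T]hsubmxK u0 tr_row_mx mul_row_col.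
  rewrite trmx0 mulmx0 add0r => /matrixP/(_ 0 0); rewrite -rowE !mxE.
  by [].
by rewrite -[u]hsubmxK u0 u1 row_mx0.
Qed.

(** Take [f] with maximal |det|: a coordinate of absolute value above 1 would allow an exchange of
    vertices that enlarges it. *)
Lemma maximal_simplex (R : realType) (d N : nat) (w : 'I_N -> 'rV[R]_d) :
  full_dim (hull w) ->
  exists f : 'I_(1 + d) -> 'I_N, homog_mx (w \o f) \in unitmx /\
    forall j i, `|bary (w \o f) (w j) 0 i| <= 1.
Proof.
move=> /full_dim_row_full wfull.
pose T (f : {ffun 'I_(1 + d) -> 'I_N}) := homog_mx (w \o f).
pose f0 : {ffun 'I_(1 + d) -> 'I_N} := fullrankfun wfull.
have uf0 : T f0 \in unitmx.
  rewrite -[T f0](_ : rowsub (fullrankfun wfull) (homog_mx w) = _).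
    exact: fullrowsub_unit.
  by apply/matrixP => i j; rewrite !mxE.
have [f _ fmax] := @arg_maxP _ R {ffun 'I_(1 + d) -> 'I_N} f0 predT
  (fun f => `|\det (T f)|) isT.
have df : 0 < `|\det (T f)|.
  apply: lt_le_trans (fmax f0 isT).
  by rewrite normr_gt0 -unitfE -unitmxE.
have uf : T f \in unitmx by rewrite unitmxE unitfE -normr_gt0.
exists f; split => // j i.
rewrite -(ler_pM2r df) mul1r -normrM -(det_replace_vertex (w j) i uf).
have := fmax [ffun k => if k == i then j else f k] isT; rewrite /= /T.
rewrite (_ : homog_mx _ = homog_mx (fun k => if k == i then w j else (w \o f) k))//.
by congr homog_mx; apply/funext => k /=; rewrite ffunE; case: ifP.
Qed.

(** * Positive representations with few generators *)

(** With [c] there are at least d + 2 points, so their homogeneous vectors are dependent. A sign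
    change makes [l0 >= 0]; the coefficients sum to 0 without all vanishing, so some [l i] is
    negative. *)
Lemma affine_dependence (R : realType) (d N : nat) (w : 'I_N -> 'rV[R]_d)
    (c : 'rV[R]_d) (A : {set 'I_N}) : (d < #|A|)%N ->
  exists (l0 : R) (l : 'I_N -> R), [/\ 0 <= l0, exists i, l i < 0,
    forall i, i \notin A -> l i = 0,
    l0 + \sum_i l i = 0 & l0 *: c + \sum_i l i *: w i = 0].
Proof.
move=> dA; have /card_gt0P[j0 j0A] : (0 < #|A|)%N by apply: leq_trans dA.
pose B : 'M[R]_(1 + #|A|, 1 + d) :=
  homog_mx (fun k =>
    match fintype.split k with inl _ => c | inr j => w (enum_val j) end).
have rB : (\rank B < 1 + #|A|)%N.
  by rewrite (leq_ltn_trans (rank_leq_col B))// ltn_add2l.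
have : ~~ row_free B by rewrite /row_free neq_ltn rB.
rewrite -kermx_eq0 => /rowV0Pn[u0 /sub_kermxP u0B u0n0].
have [u uB [u_n0 ul0]] : exists2 u : 'rV[R]_(1 + #|A|),
    u *m B = 0 & u != 0 /\ 0 <= u 0 (lshift #|A| ord0).
  have [h|h] := leP 0 (u0 0 (lshift #|A| ord0)); first by exists u0.
  by exists (- u0); rewrite ?mulNmx ?u0B ?oppr0// oppr_eq0 mxE oppr_ge0 ltW.
pose l i := if i \in A then u 0 (rshift 1 (enum_rank_in j0A i)) else 0.
have lv k : l (enum_val k) = u 0 (rshift 1 k).
  by rewrite /l enum_valP enum_valK_in.
have lS (V : lmodType R) (F : 'I_N -> V) :
    \sum_i l i *: F i = \sum_k u 0 (rshift 1 k) *: F (enum_val k).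
  rewrite (bigID (mem A))/= [X in _ + X]big1 ?addr0; last first.
    by move=> i /negbTE iA; rewrite /l iA scale0r.
  by rewrite big_enum_val; apply: eq_bigr => k _; rewrite lv.
have := mul_homog_mx (fun k =>
  match fintype.split k with inl _ => c | inr j => w (enum_val j) end) u.
rewrite -/B uB => /esym e.
have [/matrixP/(_ 0 0)] := eq_row_mx (etrans e (esym (@row_mx0 _ 1 1 d))).
rewrite !mxE mulr1n !big_split_ord !big_ord1 /=.
rewrite (unsplitK (inl _ ord0)) => s0.
under eq_bigr do rewrite (unsplitK (inr _ _)).
rewrite -(lS _ w) => sw.
have sl : \sum_i l i = \sum_k u 0 (rshift 1 k).
  have := lS R^o (fun=> 1); rewrite !(eq_bigr _ (fun i _ => mulr1 _)).
  by move=> ->.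
exists (u 0 (lshift #|A| ord0)), l; split => //.
- apply: contrapT => /forallNP ln.
  have l_ge0 k : 0 <= u 0 (rshift 1 k) by rewrite -lv leNgt; apply/negP.
  move/eqP: s0; rewrite paddr_eq0 ?sumr_ge0// psumr_eq0// => /andP[/eqP ua /allP ub].
  move/eqP: u_n0; apply; apply/rowP => k; rewrite mxE.
  case: (splitP k) => a ka.
    by rewrite (_ : k = lshift _ 0) ?ua//; apply: val_inj; rewrite /= ka ord1.
  rewrite (_ : k = rshift 1 a); last exact: val_inj.
  by have /implyP/(_ isT)/eqP := ub a (mem_index_enum a).
- by move=> i /negbTE iA; rewrite /l iA.
- by rewrite sl.
Qed.

(** The two families may overlap: [t] can also put weight on simplex vertices. *)
Definition mixed_rep (R : realType) (d N : nat) (w : 'I_N -> 'rV[R]_d)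
    (f : 'I_(1 + d) -> 'I_N) (x : 'rV[R]_d) (a : 'I_(1 + d) -> R) (t : 'I_N -> R) :=
  [/\ forall i, 0 < a i, forall j, 0 <= t j, \sum_i a i + \sum_j t j = 1
    & \sum_i a i *: w (f i) + \sum_j t j *: w j = x].

(* A weak form of Steinitz's theorem: only d further generators are needed to
   surround x together with a fixed simplex. With more of them, an affine
   dependency between these and the centroid of the simplex removes one. *)
Lemma mixed_rep_few (R : realType) (d N : nat) (w : 'I_N -> 'rV[R]_d)
    (f : 'I_(1 + d) -> 'I_N) (x : 'rV[R]_d) :
  (@interior 'rV[R]_d (hull w)) x ->
  exists a t, mixed_rep w f x a t /\ (#|[set j | t j != 0%R]%SET| <= d)%N.
Proof.
move=> xint.
pose c := (d.+1%:R)^-1 *: \sum_i w (f i).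
have c1 : \sum_(i < 1 + d) (d.+1%:R)^-1 = 1 :> R.
  by rewrite sumr_const card_ord -[LHS]mulr_natl add1n mulfV.
pose P m := `[< exists a t, mixed_rep w f x a t /\
  #|[set j | t j != 0%R]%SET| = m >].
have exP : exists m, P m.
  (* Moving [x] away from the centroid [c] to a point of the hull exhibits [x] as a mean of both,
     with weights e/(1+e) and 1/(1+e). *)
  have [e e0 [l [l0 [l1 lx]]]] := interior_extend c xint.
  have e1 : 0 < 1 + e by rewrite ltr_pwDl// ltW.
  eexists; apply/asboolP.
  exists (fun=> e / (1 + e) * (d.+1%:R)^-1), (fun j => (1 + e)^-1 * l j).
  split; last by reflexivity.
  split.
  - by move=> i; rewrite mulr_gt0 ?divr_gt0 ?invr_gt0.
  - by move=> j; rewrite mulr_ge0// invr_ge0 ltW.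
  - by rewrite -!mulr_sumr c1 l1; field; rewrite gt_eqF.
  - under eq_bigr do rewrite -scalerA.
    under [X in _ + X]eq_bigr do rewrite -scalerA.
    rewrite -!scaler_sumr -/c -lx; apply/rowP => k; rewrite !mxE.
    by field; rewrite nat1r pnatr_eq0 (gt_eqF e1).
have [m /asboolP[a [t [[a0 t0 s1 sx] tm]]] mmin] := ex_minnP exP.
exists a, t; split => //; rewrite leqNgt; apply/negP => dm.
have [l0 [l [l00 [i0 li0] lA ls lw]]] := affine_dependence w c dm.
(* The longest step along the dependency that keeps [t] nonnegative; it annihilates entry [j], while
   [l0 >= 0] never lowers the simplex weights. *)
have [j lj jmin] := @arg_minP _ R 'I_N i0 (fun i => l i < 0) (fun i => t i / - l i) li0.
pose s := t j / - l j.
have s0 : 0 <= s by rewrite divr_ge0// oppr_ge0 ltW.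
have : P #|[set i | t i + s * l i != 0%R]%SET|.
  apply/asboolP.
  exists (fun i => a i + s * l0 * (d.+1%:R)^-1), (fun i => t i + s * l i).
  split => //; split.
  - by move=> i; rewrite ltr_wpDr// mulr_ge0 ?invr_ge0// mulr_ge0.
  - move=> i; have [li|li] := leP 0 (l i); first by rewrite addr_ge0// mulr_ge0.
    have := jmin i li; rewrite -/s ler_pdivlMr ?oppr_gt0// mulrN.
    by rewrite -subr_ge0 opprK.
  - rewrite !big_split /= -!mulr_sumr c1 mulr1 addrACA s1 -mulrDr ls.
    by rewrite mulr0 addr0.
  - under eq_bigr do rewrite scalerDl -scalerA.
    under [X in _ + X]eq_bigr do rewrite scalerDl -scalerA.
    rewrite !big_split /= -!scaler_sumr -/c addrACA sx -scalerA -scalerDr lw.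
    by rewrite scaler0 addr0.
move=> /mmin; rewrite leqNgt -tm => /negP; apply.
have tj : t j != 0.
  by apply: contraTneq lj => tj; rewrite lA ?ltxx// inE tj eqxx.
have tsl : t j + s * l j = 0 by rewrite /s; field; rewrite lt_eqF.
apply: proper_card; apply/properP; split.
  apply/fintype.subsetP => i; rewrite !inE; apply: contraNneq => ti.
  by rewrite ti lA ?mulr0 ?addr0// inE ti eqxx.
exists j; rewrite !inE ?tj//.
by rewrite tsl eqxx.
Qed.

Lemma leq_sylv_prod m n : (m <= n)%N -> (sylv_prod m <= sylv_prod n)%N.
Proof.
elim: n => [|n IH]; first by rewrite leqn0 => /eqP ->.
rewrite leq_eqVlt => /predU1P[->//|/IH h]; apply: (leq_trans h).
by rewrite /= leq_pmulr.
Qed.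

(* The t j are rounded up to multiples of 1/M; re-solving for the barycentric
   part keeps it positive, because the vertices have barycentric coordinates
   of absolute value at most 1. This makes all weights rational. *)
Lemma rational_mixed_rep (R : realType) (d N : nat) (z : 'I_N -> 'rV[int]_d)
    (w := fun j => map_mx (intr : int -> R) (z j)) (f : 'I_(1 + d) -> 'I_N)
    (y : 'rV[int]_d) :
  homog_mx (w \o f) \in unitmx ->
  (forall j i, `|bary (w \o f) (w j) 0 i| <= 1) ->
  (@interior 'rV[R]_d (hull w)) (map_mx intr y) ->
  exists (U : {set 'I_N}) (D : nat) (c : 'I_(1 + d) -> nat) (T : 'I_N -> nat),
  [/\ (#|U| <= d)%N, (forall i, 0 < c i)%N, (forall j, j \in U -> 0 < T j)%N,
    (\sum_i c i + \sum_(j in U) T j)%N = D &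
    \sum_i (c i)%:Z *: z (f i) + \sum_(j in U) (T j)%:Z *: z j = D%:Z *: y].
Proof.
move=> uf bf yint.
have [a [t [[a0 t0 s1 sy] Ud]]] := mixed_rep_few f yint.
set U := [set j | _]%SET in Ud.
have tU j : j \notin U -> t j = 0 by rewrite inE negbK => /eqP.
pose m0 := \big[Order.min/1]_i a i.
have m0_gt0 : 0 < m0 by apply: lt_bigmin.
(* Ensures M a_i > d: rounding moves at most [d] weights by at most 1 each, and each move shifts a
   barycentric coordinate by at most 1. *)
pose M := Num.bound (d%:R / m0).
have dM i : d%:R < M%:R * a i.
  apply: (@lt_le_trans _ _ (M%:R * m0)); last first.
    by rewrite ler_wpM2l//; exact: bigmin_le.
  by rewrite -ltr_pdivrMr// archi_boundP// divr_ge0// ltW.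
(* The successor keeps [T j] positive on [U] even when M t_j < 1. *)
pose T j := if j \in U then (Num.truncn (M%:R * t j)).+1 else 0%N.
have TM j : `|M%:R * t j - (T j)%:R| <= (j \in U)%:R.
  rewrite /T; case: ifPn => jU; last by rewrite tU// mulr0 subr0 normr0.
  have /andP[h1 h2] := truncn_itv (mulr_ge0 (ler0n R M) (t0 j)).
  move: (Num.truncn _) h1 h2 => q; rewrite -natr1 ler_norml /= => h1 h2.
  by apply/andP; split; lra.
pose Tr : 'rV[int]_N := \row_j (T j)%:Z.
have TrE j : Tr 0 j = (T j)%:Z by rewrite mxE.
(* What the rounded weights leave of M y for the simplex, in homogeneous coordinates. *)
pose rho : 'rV[int]_(1 + d) := M%:Z *: homog y - Tr *m homog_mx z.
pose V := homog_mx (w \o f).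
have VE : V = map_mx intr (homog_mx (z \o f)) by rewrite -map_homog_mx.
have homog_y : homog (map_mx intr y) =
    (\row_i a i) *m V + (\row_j t j) *m homog_mx w.
  rewrite !mul_homog_mx add_row_mx -raddfD /homog; congr row_mx.
    by rewrite -s1; congr (_%:M); congr (_ + _); apply: eq_bigr => i _; rewrite mxE.
  by rewrite -sy; congr (_ + _); apply: eq_bigr => i _; rewrite mxE.
have kE i : (map_mx intr rho *m invmx V) 0 i =
    M%:R * a i + \sum_j (M%:R * t j - (T j)%:R) * bary (w \o f) (w j) 0 i.
  have -> : map_mx intr rho = M%:R *: ((\row_i a i) *m V) +
      (M%:R *: (\row_j t j) - \row_j (T j)%:R) *m homog_mx w.
    rewrite /rho map_mxB map_mxZ map_mxM -map_homog_mx.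
    rewrite /homog map_row_mx map_mx1 -/(homog _) homog_y scalerDr -addrA.
    congr (_ + _); rewrite mulmxBl -scalemxAl; congr (_ - _ *m _).
    by apply/rowP => j; rewrite [RHS]mxE [LHS]mxE TrE.
  rewrite mulmxDl -scalemxAl mulmxK// mxE [X in X + _]mxE mxE; congr (_ + _).
  rewrite -mulmxA mxE; apply: eq_bigr => j _; rewrite !mxE; congr (_ * _).
  by rewrite /bary ?mxE; apply: eq_bigr => k _; rewrite ?mxE.
have k_gt0 i : 0 < (map_mx intr rho *m invmx V) 0 i.
  rewrite kE -ltrBlDr sub0r; apply: le_lt_trans (dM i).
  apply: (@le_trans _ _ (#|U|%:R)); last by rewrite ler_nat.
  rewrite -sumrN -sum1_card natr_sum [leRHS]big_mkcond /=; apply: ler_sum => j _.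
  apply: (le_trans (ler_norm _)); rewrite normrN normrM.
  apply: (@le_trans _ _ ((j \in U)%:R * 1)); first by rewrite ler_pM.
  by rewrite mulr1; case: ifP.
have := @intr_invmx R _ (homog_mx (z \o f)) rho.
rewrite -VE => /(_ uf)[]; set D := `|_|%N => D0 [c cE].
have DR : (0 : R) < D%:R by rewrite ltr0n.
have c_gt0 i : 0 < c 0 i.
  by have := k_gt0 i; rewrite cE !mxE pmulr_rgt0 ?invr_gt0// ltr0z.
have cZ : c *m homog_mx (z \o f) = D%:Z *: rho.
  apply/(@map_intr_inj R); rewrite map_mxM map_mxZ -VE.
  rewrite -[map_mx _ rho](mulmxKV uf) -/V cE -scalemxAl scalerA.
  rewrite [X in X *: _](_ : _ = 1) ?scale1r//.
  exact/divff/lt0r_neq0.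
have rhoE : rho = row_mx (M%:Z - \sum_j (T j)%:Z)%:M
    (M%:Z *: y - \sum_j (T j)%:Z *: z j).
  rewrite /rho mul_homog_mx /homog scale_row_mx opp_row_mx add_row_mx.
  rewrite scale_scalar_mx mulr1 -raddfB; congr row_mx.
    by congr (_%:M); congr (_ - _); apply: eq_bigr => i _; rewrite mxE.
  by congr (_ - _); apply: eq_bigr => i _; rewrite mxE.
move: cZ; rewrite rhoE mul_homog_mx scale_row_mx => /eq_row_mx[/matrixP/(_ 0 0)].
rewrite !mxE !mulr1n => sc scz.
have cE' i : (`|c 0%R i|%N)%:Z = c 0 i by rewrite gez0_abs// ltW.
have TU (G : zmodType) (F : 'I_N -> G) : (forall j, j \notin U -> F j = 0) ->
    \sum_j F j = \sum_(j in U) F j.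
  by move=> F0; rewrite (bigID (mem U))/= [X in _ + X]big1 ?addr0.
(* Clearing the determinant [D] scales all weights, hence the denominator [M] too. *)
exists U, (D * M)%N, (fun i => `|c 0%R i|%N), (fun j => D * T j)%N; split => //.
- by move=> i; rewrite absz_gt0 gt_eqF.
- by move=> j jU; rewrite /T jU muln_gt0 D0.
- apply/eqP; rewrite -eqz_nat PoszD !(big_morph Posz PoszD (erefl _)).
  under eq_bigr do rewrite cE'.
  under [X in _ + X]eq_bigr do rewrite PoszM.
  rewrite sc -TU; last by move=> j /negbTE jU; rewrite /T jU mulr0.
  by rewrite -mulr_sumr -mulrDr subrK PoszM.
- under eq_bigr do rewrite cE'.
  under [X in _ + X]eq_bigr do rewrite PoszM -scalerA.
  rewrite scz -TU; last by move=> j /negbTE jU; rewrite /T jU scale0r scaler0.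
  by rewrite -scaler_sumr -scalerDr subrK PoszM scalerA.
Qed.

(** * Deep lattice points and the volume bound *)

(** The simplex vertices and the extra generators form one family of at most 2d + 1 points, possibly
    with repetitions, which [large_min_coords] allows. Monotonicity of [sylv_prod] makes the bound
    uniform. *)
Lemma deep_lattice_point (R : realType) (d N : nat) (z : 'I_N -> 'rV[int]_d)
    (w := fun j => map_mx (intr : int -> R) (z j)) (f : 'I_(1 + d) -> 'I_N)
    (x : 'rV[int]_d) :
  homog_mx (w \o f) \in unitmx ->
  (forall j i, `|bary (w \o f) (w j) 0 i| <= 1) ->
  (@interior 'rV[R]_d (hull w)) (map_mx intr x) ->
  exists (u : nat) (g : 'I_(1 + d + u) -> 'I_N) (b : 'I_(1 + d + u) -> R)
    (y : 'rV[int]_d),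
  [/\ forall i, g (lshift u i) = f i,
    forall k, (((2 * d + 1) * sylv_prod (2 * d))%:R)^-1 <= b k, \sum_k b k = 1 &
    \sum_k b k *: w (g k) = map_mx intr y].
Proof.
move=> uf bf xint.
have [U [D [c [T [Ud c0 T0 sD sx]]]]] := rational_mixed_rep uf bf xint.
pose g (k : 'I_(1 + d + #|U|)) :=
  match fintype.split k with inl i => f i | inr j => enum_val j end.
pose b0 (k : 'I_(1 + d + #|U|)) :=
  match fintype.split k with inl i => c i | inr j => T (enum_val j) end.
have gl i : g (lshift #|U| i) = f i by rewrite /g (unsplitK (inl _ i)).
have gr j : g (rshift (1 + d) j) = enum_val j by rewrite /g (unsplitK (inr _ j)).
have bl i : b0 (lshift #|U| i) = c i by rewrite /b0 (unsplitK (inl _ i)).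
have br j : b0 (rshift (1 + d) j) = T (enum_val j).
  by rewrite /b0 (unsplitK (inr _ j)).
have [|||b [bD [y yE] bmin]] :=
    @large_min_coords (d + #|U|) d (fun k => z (g k)) b0 D.
- rewrite (@big_split_ord _ _ _ (1 + d) #|U| xpredT b0) -sD.
  rewrite [X in _ = (_ + X)%N]big_enum_val /=.
  by congr (_ + _)%N; apply: eq_bigr => i _; rewrite ?bl ?br.
- move=> k; rewrite /b0; case: fintype.split => j; first exact: c0.
  by apply: T0; exact: enum_valP.
- exists x; rewrite -sx.
  rewrite (@big_split_ord _ _ _ (1 + d) #|U| xpredT (fun k => (b0 k)%:Z *: z (g k))).
  rewrite [X in _ = _ + X]big_enum_val /=.
  by congr (_ + _); apply: eq_bigr => i _; rewrite ?bl ?gl ?br ?gr.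
have D0 : (0 < D)%N.
  rewrite -sD (bigD1 0)//= addn_gt0 addn_gt0 c0//.
have DR : (0 : R) < D%:R by rewrite ltr0n.
exists #|U|, g, (fun k => (b k)%:R / D%:R), y; split => //.
- move=> k; rewrite ler_pdivlMr// mulrC ler_pdivrMr; last first.
    by rewrite ltr0n muln_gt0 addn1 sylv_prod_gt0.
  rewrite -natrM ler_nat (leq_trans (bmin k))// mulnC leq_mul// leq_mul//.
    by rewrite addn1 ltnS mul2n -addnn leq_add2l.
  by rewrite leq_sylv_prod// mul2n -addnn leq_add2l.
- by rewrite -mulr_suml -natr_sum bD mulfV ?gt_eqF.
- under eq_bigr do rewrite mulrC -scalerA.
  rewrite -scaler_sumr -map_intr_lincomb yE map_mxZ scalerA.
  rewrite [X in X *: _](_ : _ = 1) ?scale1r//.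
  exact/mulVf/lt0r_neq0.
Qed.

(** There are only q^d residue vectors modulo [q]. *)
Lemma congruence_pigeonhole (d q k : nat) (s : seq 'rV[int]_d) :
  (0 < q)%N -> uniq s -> (k * q ^ d < size s)%N ->
  exists t : seq 'rV[int]_d, [/\ uniq t, (k < size t)%N, {subset t <= s} &
    forall x y, x \in t -> y \in t -> exists v, x - y = q%:Z *: v].
Proof.
case: q => // q _ us big.
pose key (x : 'rV[int]_d) : {ffun 'I_d -> 'I_q.+1} :=
  [ffun i => inord `|(x 0%R i %% q.+1%:Z)%Z|%N].
have [c cbig] : exists c, (k < count (fun x => key x == c) s)%N.
  apply: contrapT => /forallNP small; move: big; rewrite ltnNge => /negP; apply.
  rewrite -sum1_size (partition_big key predT)//=.
  apply: (@leq_trans (\sum_(c : {ffun 'I_d -> 'I_q.+1}) k)%N).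
    apply: leq_sum => c _; rewrite sum1_count leqNgt; apply/negP; exact: small.
  by rewrite sum_nat_const card_ffun !card_ord mulnC.
exists [seq x <- s | key x == c]; split; first exact: filter_uniq.
- by rewrite size_filter.
- by move=> x; rewrite mem_filter => /andP[].
move=> x y; rewrite !mem_filter => /andP[/eqP xc _] /andP[/eqP yc _].
exists (\row_i ((x - y) 0%R i %/ q.+1%:Z)%Z); apply/rowP => i.
have keyE z : (key z i : nat)%:Z = (z 0%R i %% q.+1%:Z)%Z.
  have z0 : 0 <= (z 0%R i %% q.+1%:Z)%Z by rewrite modz_ge0.
  have zq : (z 0%R i %% q.+1%:Z)%Z < q.+1%:Z by rewrite ltz_pmod.
  by rewrite ffunE inordK ?gez0_abs// -ltz_nat gez0_abs.
have dv : (q.+1%:Z %| (x - y) 0%R i)%Z.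
  have -> : (x - y) 0 i = x 0 i - y 0 i by rewrite !mxE.
  by rewrite -eqz_mod_dvd -(keyE x) -(keyE y) xc yc.
by rewrite [RHS]mxE [X in _ * X]mxE mulrC divzK.
Qed.

Lemma dcube_center (R : realType) (d n : nat) (z : 'rV[int]_d) (P : set 'rV[R]_d) :
  dcube (R:=R) n z `<=` P ->
  (@interior 'rV[R]_d P) ((2 ^+ n)^-1 *: (map_mx intr z + const_mx 2^-1)).
Proof.
move=> zP; apply/interior_rowP; exists ((2 ^+ n)^-1 / 2).
  by rewrite divr_gt0// invr_gt0 exprn_gt0.
have n0 : (0 : R) < (2 ^+ n)^-1 by rewrite invr_gt0 exprn_gt0.
move=> x xz; apply: zP => i; have := xz i; rewrite !mxE.
move: n0; set a := (2 ^+ n)^-1; set b : R := (z 0 i)%:~R => a0.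
by rewrite ltr_norml => /andP[h1 h2]; apply/andP; split; lra.
Qed.

(** Write y for the sum of the [b k *: w (g k)]. The point is t p + (1 - t) r with r = (y - t q)/(1
    - t). As [q] has simplex coordinates [c k <= 1], the weights (b_k - t c_k)/(1 - t) of [r] are
    nonnegative. *)
Lemma deep_point_interior (R : realType) (d N u : nat) (w : 'I_N -> 'rV[R]_d)
    (f : 'I_(1 + d) -> 'I_N) (g : 'I_(1 + d + u) -> 'I_N)
    (b : 'I_(1 + d + u) -> R) (t : R) p q :
  homog_mx (w \o f) \in unitmx ->
  (forall j i, `|bary (w \o f) (w j) 0 i| <= 1) ->
  (forall i, g (lshift u i) = f i) -> (forall k, t <= b k) -> \sum_k b k = 1 ->
  0 < t < 1 -> (@interior 'rV[R]_d (hull w)) p -> hull w q ->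
  (@interior 'rV[R]_d (hull w)) (\sum_k b k *: w (g k) + t *: (p - q)).
Proof.
move=> uf bf gf tb b1 /andP[t0 t1] wp wq.
pose c (k : 'I_(1 + d + u)) : R :=
  match fintype.split k with inl i => bary (w \o f) q 0 i | inr _ => 0 end.
have cl i : c (lshift u i) = bary (w \o f) q 0 i by rewrite /c (unsplitK (inl _ i)).
have cr j : c (rshift (1 + d) j) = 0 by rewrite /c (unsplitK (inr _ j)).
have [s1 sq] := baryP uf q.
have c1 : \sum_k c k = 1.
  rewrite big_split_ord /= [X in _ + X]big1 ?addr0; last by move=> j _; rewrite cr.
  by rewrite -s1; apply: eq_bigr => i _; rewrite cl.
have cq : \sum_k c k *: w (g k) = q.
  rewrite big_split_ord /= [X in _ + X]big1 ?addr0; last first.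
    by move=> j _; rewrite cr scale0r.
  by rewrite -[RHS]sq; apply: eq_bigr => i _; rewrite cl gf.
have cle k : c k <= 1.
  rewrite /c; case: fintype.split => // i.
  have [l [l0 [l1 ->]]] := wq.
  rewrite (bary_comb uf w i l1) -l1; apply: ler_sum => j _.
  by rewrite ler_piMr//; apply: le_trans (bf j i); exact: ler_norm.
have t1' : 1 - t != 0 by lra.
pose r := \sum_k (1 - t)^-1 * (b k - t * c k) *: w (g k).
have rE : (1 - t) *: r = \sum_k b k *: w (g k) - t *: q.
  rewrite /r scaler_sumr -[in RHS]cq scaler_sumr -sumrB.
  apply: eq_bigr => k _; rewrite !scalerA -scalerBl.
  by congr (_ *: _); field.
have -> : \sum_k b k *: w (g k) + t *: (p - q) = t *: p + (1 - t) *: r.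
  by rewrite rE scalerBr addrCA.
apply: interior_segment => //; last by rewrite t0 ltW.
apply: hull_comb => [k|k|].
- exact: hull_vertex.
- rewrite mulr_ge0 ?invr_ge0 ?subr_ge0 ?(ltW t1)// (le_trans _ (tb k))//.
  by rewrite ler_piMr// ltW.
- by rewrite -mulr_sumr sumrB -mulr_sumr b1 c1 mulr1 mulVf.
Qed.

Lemma polytope_vol_le (R : realType) (d k : nat) (P : set 'rV[R]_d)
    (M := (d * (2 * d + 1) * sylv_prod (2 * d))%N) :
  (0 < d)%N -> (0 < k)%N -> in_P k P -> vol P <= (M ^ d * k)%:R.
Proof.
move=> d0 k0 [[N [w [wl ->]]] wfull [si [_ sk siP]]].
have [z zE] := choice wl.
have {zE}wE : w = fun j => map_mx intr (z j) by apply/funext.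
have [x0 [x0i [x x0E]]] : exists x, int_lattice_pt (hull w) x.
  case: si sk siP => [sk|x si _ siP]; first by rewrite -sk in k0.
  by exists x; apply/siP; rewrite mem_head.
have [f [uf bf]] := maximal_simplex wfull.
have [u [g [b [y [gf bge b1 yE]]]]] : exists u g b y, [/\
    forall i, g (lshift u i) = f i,
    forall j, (((2 * d + 1) * sylv_prod (2 * d))%:R)^-1 <= b j, \sum_j b j = 1 &
    \sum_j b j *: w (g j) = map_mx intr y].
  rewrite {}x0E in x0i; clear M.
  by subst w; exact: deep_lattice_point uf bf x0i.
have Q0 := sylv_prod_gt0 (2 * d).
have M1 : (1 < M)%N by rewrite /M; nia.
pose t : R := (M%:R)^-1.
have t01 : 0 < t < 1.
  by rewrite invr_gt0 ltr0n (ltnW M1) invf_lt1 ?ltr1n ?ltr0n// ltnW.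
have tb j : t <= b j.
  apply: le_trans (bge j).
  rewrite lef_pV2 ?posrE ?ltr0n ?(ltnW M1) ?muln_gt0 ?addn1//.
  by rewrite ler_nat /M -mulnA addn1 leq_pmull.
(* The empty family of cubes shows that the supremum is over a nonempty set. *)
apply: ge_sup; first by exists 0, 0%N, [::]; split => //; rewrite mul0r.
move=> _ [n [s [us sP ->]]]; rewrite ler_pdivrMr ?exprn_gt0//.
rewrite -natrX -natrM ler_nat leqNgt; apply/negP => big.
(* Cube centres scaled by 1/M lie in a translate of the grid of mesh 1/q, so indices congruent
   modulo [q] give scaled centres that differ by lattice vectors. *)
pose q := (M * 2 ^ n)%N.
have q0 : (0 < q)%N by rewrite muln_gt0 expn_gt0 ltnW.
have [|T [uT kT Ts Tq]] := congruence_pigeonhole (k := k) q0 us.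
  by rewrite expnMn -expnM mulnA [(k * _)%N]mulnC.
case: T uT kT Ts Tq => // z0 T uT kT Ts Tq.
have z0T : z0 \in z0 :: T by rewrite mem_head.
have qR : (q%:R : R) != 0 by rewrite pnatr_eq0 -lt0n.
pose h (v : 'rV[int]_d) : 'rV[R]_d :=
  map_mx intr y + (q%:R)^-1 *: (map_mx intr v - map_mx intr z0).
have hinj : injective h.
  move=> v v' /addrI/(scalerI (_ : (q%:R)^-1 != 0)).
  by rewrite invr_eq0 => /(_ qR)/addIr/map_intr_inj.
have : (size [seq h v | v <- z0 :: T] <= size si)%N.
  apply: uniq_leq_size; first by rewrite map_inj_uniq.
  move=> _ /mapP[v vT ->]; apply/siP; split; last first.
    have [v' v'E] := Tq _ _ vT z0T; exists (y + v').
    rewrite /h -map_mxB v'E map_mxZ scalerA map_mxD.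
    rewrite [X in X *: _](_ : _ = 1) ?scale1r//; exact: mulVf.
  pose cen v := ((2:R) ^+ n)^-1 *: (map_mx intr v + const_mx 2^-1) : 'rV[R]_d.
  have cenP v' : v' \in z0 :: T -> (@interior 'rV[R]_d (hull w)) (cen v').
    by move=> /Ts /sP; exact: dcube_center.
  have -> : h v = \sum_k b k *: w (g k) + t *: (cen v - cen z0).
    rewrite /h -yE; congr (_ + _).
    rewrite /cen -scalerBr opprD addrACA subrr addr0 scalerA; congr (_ *: _).
    by rewrite /q natrM natrX invfM.
  apply: (deep_point_interior uf bf gf tb b1 t01 (cenP _ vT)).
  exact: interior_subset (cenP _ z0T).
by rewrite size_map sk leqNgt kT.
Qed.

Unset Implicit Arguments.
Set Strict Implicit.

Theorem theorem1p4 (R : realType) (d k : nat) (hd : (0 < d)%N) (hk : (0 < k)%N) :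
  (* (a) *)
  (forall (S : set 'rV[R]_d) (v : 'I_d.+1 -> 'rV[R]_d),
     in_S k S -> simplex_with_vertices v S ->
     exists x : 'rV[R]_d, int_lattice_pt S x /\
       exists b : 'I_d.+1 -> R, barycentric v x b /\
         forall i, ((d.+1 * (sylv d.+1 - 1))%N%:R)^-1 <= b i)
  /\
  (* (b) p(d,k) <= (d(2d+1)(s_{2d+1}-1))^d k *)
  (forall P : set 'rV[R]_d, in_P k P ->
     vol P <= ((d * (2 * d + 1) * (sylv (2 * d + 1) - 1)) ^ d * k)%N%:R).
Proof.
have sE m : (sylv m.+1 - 1)%N = sylv_prod m by rewrite /sylv subn1.
split=> [S v kS vS|P kP].
  by rewrite sE; exact: simplex_deep_point kS vS.
by rewrite addn1 sE -addn1; exact: polytope_vol_le.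
Qed.
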